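(* Let $p$ be a prime. Let $A$ and $B$ be finitely generated groups and let $\phi:A\to B$ be a homomorphism that induces an isomorphism (respectively, a monomorphism) on $H_1(-;\mathbb{Z}_p)$ and an epimorphism on $H_2(-;\mathbb{Z}_p)$. Then for each finite $n$, $\phi$ induces an isomorphism (respectively, a monomorphism) $A/A^{(n)}\to B/B^{(n)}$. Moreover $\phi$ induces a monomorphism $A/A^{(\omega)}\to B/B^{(\omega)}$.
   Context: $\mathbb{Z}_p$ denotes the integers modulo $p$. For a group $G$, the derived $p$-series $\{G^{(n)}\}_{n\ge 0}$ is defined by $G^{(0)}=G$ and $G^{(n+1)}=[G^{(n)},G^{(n)}](G^{(n)})^p$, i.e. the subgroup generated by commutators and $p$-th powers of elements of $G^{(n)}$ (the prime $p$ is suppressed from the notation). Also $G^{(\omega)}=\bigcap_{n=1}^\infty G^{(n)}$. *)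

(* Defs.v *)
From HB Require Import structures.
From mathcomp Require Import all_boot ssralg boolp zify.
From mathcomp.multinomials Require Import freeg.

Set Implicit Arguments.
Unset Strict Implicit.
Unset Printing Implicit Defensive.

Import GRing.Theory.
Local Open Scope ring_scope.
Local Open Scope quotient_scope.

Definition surjective (T U : Type) (f : T -> U) : Prop :=
  forall y, exists x, f x = y.

HB.mixin Record isConjClosed (G : groupType) (S : {pred G}) := {
  gpredJn : forall x y, x \in S -> (x ^ y)%g \in S
}.

#[short(type="normalClosed")]
HB.structure Definition NormalClosed (G : groupType) :=
  {S of GroupClosed G S & isConjClosed G S}.

Section GroupQuotient.
Variables (G : groupType) (N : normalClosed G).

Definition gquot_equiv (x y : G) : bool := (x^-1 * y)%g \in N.

Lemma gquot_equiv_refl : reflexive gquot_equiv.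
Proof. by move=> x; rewrite /gquot_equiv mulVg gpred1. Qed.

Lemma gquot_equiv_sym : symmetric gquot_equiv.
Proof. by move=> x y; rewrite /gquot_equiv -gpredV invgM invgK. Qed.

Lemma gquot_equiv_trans : transitive gquot_equiv.
Proof.
move=> y x z Nxy Nyz; rewrite /gquot_equiv.
by have := gpredM _ _ Nxy Nyz; rewrite -mulgA mulVKg.
Qed.

Canonical gquot_equiv_rel :=
  EquivRel gquot_equiv gquot_equiv_refl gquot_equiv_sym gquot_equiv_trans.
Canonical gquot_encModRel := defaultEncModRel gquot_equiv.

Definition gquot : Type := {eq_quot gquot_equiv}.

HB.instance Definition _ := Choice.on gquot.
HB.instance Definition _ := EqQuotient.on gquot.

Lemma gquot_eqP (x y : G) : reflect (x = y %[mod gquot]) ((x^-1 * y)%g \in N).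
Proof. exact: (@eqmodP G gquot_equiv_rel). Qed.

Definition gquot_one : gquot := lift_cst gquot 1%g.
Definition gquot_mul := lift_op2 gquot (fun x y : G => x * y)%g.
Definition gquot_inv := lift_op1 gquot (fun x : G => x^-1)%g.

Fact pi_gquot_one : \pi_gquot 1%g = gquot_one.
Proof. by unlock gquot_one. Qed.

Fact pi_gquot_mul : {morph \pi_gquot : x y / (x * y)%g >-> gquot_mul x y}.
Proof.
move=> x y; unlock gquot_mul.
have /gquot_eqP Nx := esym (reprK (\pi_gquot x)).
have /gquot_eqP Ny := esym (reprK (\pi_gquot y)).
apply/gquot_eqP.
have -> : ((x * y)^-1 * (repr (\pi_gquot x) * repr (\pi_gquot y)) =
  (x^-1 * repr (\pi_gquot x)) ^ y * (y^-1 * repr (\pi_gquot y)))%g.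
  by rewrite conjgE invgM !mulgA mulgK.
by rewrite gpredM // gpredJn.
Qed.

Fact pi_gquot_inv : {morph \pi_gquot : x / x^-1%g >-> gquot_inv x}.
Proof.
move=> x; unlock gquot_inv.
have /esym/gquot_eqP Nx := esym (reprK (\pi_gquot x)); apply/gquot_eqP.
have := gpredJn _ (repr (\pi_gquot x))^-1%g Nx.
by rewrite conjgE !invgK !mulgA mulgV mul1g.
Qed.

Fact gquot_mulA : associative gquot_mul.
Proof.
by move=> u v w; rewrite -[u]reprK -[v]reprK -[w]reprK -!pi_gquot_mul mulgA.
Qed.

Fact gquot_1mul : left_id gquot_one gquot_mul.
Proof. by move=> u; rewrite -[u]reprK -pi_gquot_one -pi_gquot_mul mul1g. Qed.

Fact gquot_mul1 : right_id gquot_one gquot_mul.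
Proof. by move=> u; rewrite -[u]reprK -pi_gquot_one -pi_gquot_mul mulg1. Qed.

Fact gquot_Vmul : left_inverse gquot_one gquot_inv gquot_mul.
Proof.
by move=> u; rewrite -[u]reprK -pi_gquot_one -pi_gquot_inv -pi_gquot_mul mulVg.
Qed.

Fact gquot_mulV : right_inverse gquot_one gquot_inv gquot_mul.
Proof.
by move=> u; rewrite -[u]reprK -pi_gquot_one -pi_gquot_inv -pi_gquot_mul mulgV.
Qed.

HB.instance Definition _ := isGroup.Build gquot
  gquot_mulA gquot_1mul gquot_mul1 gquot_Vmul gquot_mulV.

Lemma pi_gquot1 : \pi_gquot 1%g = 1%g.
Proof. exact: pi_gquot_one. Qed.

Lemma pi_gquotM : {morph \pi_gquot : x y / (x * y)%g}.
Proof. exact: pi_gquot_mul. Qed.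

End GroupQuotient.

Section GroupQuotientMap.
Variables (G H : groupType) (N : normalClosed G) (M : normalClosed H).
Variables (f : UMagmaMorphism.type G H).
Variable fNM : {homo f : x / x \in N >-> x \in M}.

(* xN |-> f(x)M; the hypothesis makes it independent of the representative. *)
Definition gquot_map of {homo f : x / x \in N >-> x \in M} :
  gquot N -> gquot M := fun u => \pi_(gquot M) (f (repr u)).

Lemma gquot_mapE (x : G) :
  gquot_map fNM (\pi_(gquot N) x) = \pi_(gquot M) (f x).
Proof.
apply/gquot_eqP; rewrite -gmulfV -gmulfM.
by apply/fNM/gquot_eqP; rewrite reprK.
Qed.

Fact gquot_map_monoid_morphism : monoid.monoid_morphism (gquot_map fNM).
Proof.
split; first by rewrite -pi_gquot1 gquot_mapE gmulf1 pi_gquot1.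
move=> u v; rewrite -[u]reprK -[v]reprK.
by rewrite -pi_gquotM !gquot_mapE gmulfM pi_gquotM.
Qed.

HB.instance Definition _ := isUMagmaMorphism.Build (gquot N) (gquot M)
  (gquot_map fNM) gquot_map_monoid_morphism.

End GroupQuotientMap.

(* Subsets of a group are boolean predicates {pred G}; asbool turns any
   proposition into one.  Group homomorphisms are the unital multiplicative maps
   UMagmaMorphism.type G H. *)
Section Generated.
Variables (G : groupType) (S : {pred G}).

Definition generated : {pred G} :=
  [pred x | `[< forall K : groupClosed G, {subset S <= K} -> x \in K >]].

Lemma generatedP (x : G) :
  reflect (forall K : groupClosed G, {subset S <= K} -> x \in K)
          (x \in generated).
Proof. exact: asboolP. Qed.

Lemma sub_generated : {subset S <= generated}.
Proof. by move=> x Sx; apply/generatedP => K; apply. Qed.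

Fact generatedM : mulg_closed generated.
Proof.
move=> x y /generatedP gx /generatedP gy; apply/generatedP => K SK.
by rewrite gpredM ?gx ?gy.
Qed.

Fact generated1 : 1%g \in generated.
Proof. by apply/generatedP => K _; exact: gpred1. Qed.

Fact generatedV : invg_closed generated.
Proof.
by move=> x /generatedP gx; apply/generatedP => K /gx; rewrite gpredV.
Qed.

HB.instance Definition _ := isMulClosed.Build G generated generatedM.
HB.instance Definition _ := isMul1Closed.Build G generated generated1.
HB.instance Definition _ := isInvClosed.Build G generated generatedV.

End Generated.

Definition finitely_generated (G : groupType) : Prop :=
  exists s : seq G, forall x : G, x \in generated [pred y | y \in s].

Section Preimage.
Variables (G H : groupType) (f : UMagmaMorphism.type G H) (K : groupClosed H).

Definition preim_pred : {pred G} := [pred x | f x \in K].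

Fact preim_predM : mulg_closed preim_pred.
Proof. by move=> x y; rewrite !inE gmulfM => *; rewrite gpredM. Qed.
Fact preim_pred1 : 1%g \in preim_pred.
Proof. by rewrite inE gmulf1 gpred1. Qed.
Fact preim_predV : invg_closed preim_pred.
Proof. by move=> x; rewrite !inE gmulfV gpredV. Qed.

HB.instance Definition _ := isMulClosed.Build G preim_pred preim_predM.
HB.instance Definition _ := isMul1Closed.Build G preim_pred preim_pred1.
HB.instance Definition _ := isInvClosed.Build G preim_pred preim_predV.

End Preimage.

Lemma generated_homo (G H : groupType) (f : UMagmaMorphism.type G H)
    (S : {pred G}) (T : {pred H}) :
  {homo f : x / x \in S >-> x \in T} ->
  {homo f : x / x \in generated S >-> x \in generated T}.
Proof.
move=> fST x /generatedP gx; apply/generatedP => K TK.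
by apply: (gx (preim_pred f K)) => y /fST/TK.
Qed.

Section Conjugation.
Variables (G : groupType) (y : G).
Definition conj_by (x : G) : G := (x ^ y)%g.
Fact conj_by_monoid_morphism : monoid.monoid_morphism conj_by.
Proof. by split; [exact: conj1g | move=> u v; exact: conjMg]. Qed.
HB.instance Definition _ :=
  isUMagmaMorphism.Build G G conj_by conj_by_monoid_morphism.
End Conjugation.

Section DerivedPSeries.
Variable p : nat.

Section Def.
Variable G : groupType.

Definition comm_pow (K : {pred G}) : {pred G} :=
  [pred z | `[< (exists x y, [/\ x \in K, y \in K & z = [~ x, y]%g])
             \/ (exists2 x, x \in K & z = (x ^+ p)%g) >]].

Fixpoint derived_pseries (n : nat) : {pred G} :=
  if n is m.+1 then generated (comm_pow (derived_pseries m)) else predT.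

Definition derived_pseries_omega : {pred G} :=
  [pred x | `[< forall n, x \in derived_pseries n.+1 >]].

End Def.

Arguments derived_pseries : clear implicits.
Arguments derived_pseries_omega : clear implicits.

Lemma derived_pseries_homo (G H : groupType) (f : UMagmaMorphism.type G H) n :
  {homo f : x / x \in derived_pseries G n >-> x \in derived_pseries H n}.
Proof.
elim: n => [//|n IHn]; apply: generated_homo => z /asboolP Kz; apply/asboolP.
case: Kz => [[x [y [Kx Ky ->]]] | [x Kx ->]]; [left | right].
  by exists (f x), (f y); rewrite gmulfR !IHn.
by exists (f x); rewrite ?gmulfXn ?IHn.
Qed.

Lemma derived_pseries_omega_homo (G H : groupType)
    (f : UMagmaMorphism.type G H) :
  {homo f : x / x \in derived_pseries_omega G >->
                x \in derived_pseries_omega H}.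
Proof.
move=> x /asboolP Gx; apply/asboolP => n.
exact: derived_pseries_homo (Gx n).
Qed.

Section Normal.
Variable G : groupType.

Section Finite.
Variable n : nat.

Fact derived_pseriesM : mulg_closed (derived_pseries G n).
Proof. by case: n => [//|m]; exact: generatedM. Qed.
Fact derived_pseries1 : 1%g \in derived_pseries G n.
Proof. by case: n => [//|m]; exact: generated1. Qed.
Fact derived_pseriesV : invg_closed (derived_pseries G n).
Proof. by case: n => [//|m]; exact: generatedV. Qed.
Fact derived_pseriesJ (x y : G) :
  x \in derived_pseries G n -> (x ^ y)%g \in derived_pseries G n.
Proof. exact: (@derived_pseries_homo _ _ (conj_by y)). Qed.

HB.instance Definition _ :=
  isMulClosed.Build G (derived_pseries G n) derived_pseriesM.
HB.instance Definition _ :=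
  isMul1Closed.Build G (derived_pseries G n) derived_pseries1.
HB.instance Definition _ :=
  isInvClosed.Build G (derived_pseries G n) derived_pseriesV.
HB.instance Definition _ :=
  isConjClosed.Build G (derived_pseries G n) derived_pseriesJ.

End Finite.

Fact derived_pseries_omegaM : mulg_closed (derived_pseries_omega G).
Proof.
move=> x y /asboolP Gx /asboolP Gy; apply/asboolP => n.
exact: derived_pseriesM.
Qed.
Fact derived_pseries_omega1 : 1%g \in derived_pseries_omega G.
Proof. by apply/asboolP => n; exact: derived_pseries1. Qed.
Fact derived_pseries_omegaV : invg_closed (derived_pseries_omega G).
Proof.
by move=> x /asboolP Gx; apply/asboolP => n; exact: derived_pseriesV.
Qed.
Fact derived_pseries_omegaJ (x y : G) :
  x \in derived_pseries_omega G -> (x ^ y)%g \in derived_pseries_omega G.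
Proof. exact: (@derived_pseries_omega_homo _ _ (conj_by y)). Qed.

HB.instance Definition _ :=
  isMulClosed.Build G (derived_pseries_omega G) derived_pseries_omegaM.
HB.instance Definition _ :=
  isMul1Closed.Build G (derived_pseries_omega G) derived_pseries_omega1.
HB.instance Definition _ :=
  isInvClosed.Build G (derived_pseries_omega G) derived_pseries_omegaV.
HB.instance Definition _ :=
  isConjClosed.Build G (derived_pseries_omega G) derived_pseries_omegaJ.

End Normal.

Section InducedMaps.
Variables (G H : groupType) (f : UMagmaMorphism.type G H).

Definition pseries_quot_map (n : nat) :
    gquot (derived_pseries G n) -> gquot (derived_pseries H n) :=
  gquot_map (@derived_pseries_homo G H f n).

Definition pseries_omega_quot_map :
    gquot (derived_pseries_omega G) -> gquot (derived_pseries_omega H) :=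
  gquot_map (@derived_pseries_omega_homo G H f).

Arguments pseries_quot_map : clear implicits.

HB.instance Definition _ n := UMagmaMorphism.on (pseries_quot_map n).
HB.instance Definition _ := UMagmaMorphism.on pseries_omega_quot_map.

End InducedMaps.

End DerivedPSeries.

Arguments pseries_quot_map p [G H] f n _.
Arguments pseries_omega_quot_map p [G H] f _.

Section ModuleQuotient.
Variables (R : nzRingType) (V : lmodType R) (W : submodClosed V).

(* submodClosed is stated for semimodules, so it does not bundle this. *)
Let submodN : oppr_closed W.
Proof. by move=> x Wx; rewrite -scaleN1r rpredZ. Qed.

Definition mquot_equiv (x y : V) : bool := x - y \in W.

Lemma mquot_equiv_refl : reflexive mquot_equiv.
Proof. by move=> x; rewrite /mquot_equiv subrr rpred0. Qed.

Lemma mquot_equiv_sym : symmetric mquot_equiv.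
Proof.
move=> x y; rewrite /mquot_equiv.
by apply/idP/idP => /submodN; rewrite opprB.
Qed.

Lemma mquot_equiv_trans : transitive mquot_equiv.
Proof.
move=> y x z Wxy Wyz; rewrite /mquot_equiv.
by rewrite -(subrKA y) rpredD.
Qed.

Canonical mquot_equiv_rel :=
  EquivRel mquot_equiv mquot_equiv_refl mquot_equiv_sym mquot_equiv_trans.
Canonical mquot_encModRel := defaultEncModRel mquot_equiv.

Definition mquot : Type := {eq_quot mquot_equiv}.

HB.instance Definition _ := Choice.on mquot.
HB.instance Definition _ := EqQuotient.on mquot.

Lemma mquot_eqP (x y : V) : reflect (x = y %[mod mquot]) (x - y \in W).
Proof. exact: (@eqmodP V mquot_equiv_rel). Qed.

Definition mquot_zero : mquot := lift_cst mquot 0.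
Definition mquot_add := lift_op2 mquot (fun x y : V => x + y).
Definition mquot_opp := lift_op1 mquot (fun x : V => - x).
Definition mquot_scale (a : R) := lift_op1 mquot (fun x : V => a *: x).

Fact pi_mquot_zero : \pi_mquot 0 = mquot_zero.
Proof. by unlock mquot_zero. Qed.

Fact pi_mquot_add : {morph \pi_mquot : x y / x + y >-> mquot_add x y}.
Proof.
move=> x y; unlock mquot_add.
have /mquot_eqP Wx := esym (reprK (\pi_mquot x)).
have /mquot_eqP Wy := esym (reprK (\pi_mquot y)).
by apply/mquot_eqP; rewrite opprD addrACA rpredD.
Qed.

Fact pi_mquot_opp : {morph \pi_mquot : x / - x >-> mquot_opp x}.
Proof.
move=> x; unlock mquot_opp.
have /mquot_eqP Wx := esym (reprK (\pi_mquot x)).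
by apply/mquot_eqP; rewrite -opprD; exact: submodN.
Qed.

Fact pi_mquot_scale (a : R) :
  {morph \pi_mquot : x / a *: x >-> mquot_scale a x}.
Proof.
move=> x; unlock mquot_scale.
have /mquot_eqP Wx := esym (reprK (\pi_mquot x)).
by apply/mquot_eqP; rewrite -scalerBr rpredZ.
Qed.

Fact mquot_addA : associative mquot_add.
Proof.
by move=> u v w; rewrite -[u]reprK -[v]reprK -[w]reprK -!pi_mquot_add addrA.
Qed.

Fact mquot_addC : commutative mquot_add.
Proof.
by move=> u v; rewrite -[u]reprK -[v]reprK -!pi_mquot_add addrC.
Qed.

Fact mquot_add0 : left_id mquot_zero mquot_add.
Proof. by move=> u; rewrite -[u]reprK -pi_mquot_zero -pi_mquot_add add0r. Qed.

Fact mquot_addN : left_inverse mquot_zero mquot_opp mquot_add.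
Proof.
by move=> u; rewrite -[u]reprK -pi_mquot_zero -pi_mquot_opp -pi_mquot_add addNr.
Qed.

HB.instance Definition _ := GRing.isZmodule.Build mquot
  mquot_addA mquot_addC mquot_add0 mquot_addN.

Lemma pi_mquotD : {morph \pi_mquot : x y / x + y}.
Proof. exact: pi_mquot_add. Qed.

Fact mquot_scaleA a b (u : mquot) :
  mquot_scale a (mquot_scale b u) = mquot_scale (a * b) u.
Proof. by rewrite -[u]reprK -!pi_mquot_scale scalerA. Qed.

Fact mquot_scale1 : left_id 1 mquot_scale.
Proof. by move=> u; rewrite -[u]reprK -pi_mquot_scale scale1r. Qed.

Fact mquot_scaleDr : right_distributive mquot_scale +%R.
Proof.
move=> a u v; rewrite -[u]reprK -[v]reprK.
by rewrite -pi_mquotD -!pi_mquot_scale scalerDr pi_mquotD.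
Qed.

Fact mquot_scaleDl (u : mquot) :
  {morph mquot_scale^~ u : a b / a + b}.
Proof.
by move=> a b; rewrite -[u]reprK -!pi_mquot_scale scalerDl pi_mquotD.
Qed.

HB.instance Definition _ := GRing.Zmodule_isLmodule.Build R mquot
  mquot_scaleA mquot_scale1 mquot_scaleDr mquot_scaleDl.

Lemma pi_mquotZ (a : R) : {morph \pi_mquot : x / a *: x}.
Proof. exact: pi_mquot_scale. Qed.

End ModuleQuotient.

Section ModuleQuotientMap.
Variables (R : nzRingType) (V V' : lmodType R).
Variables (W : submodClosed V) (W' : submodClosed V').
Variables (f : {linear V -> V'}) (fWW' : {homo f : x / x \in W >-> x \in W'}).

Definition mquot_map of {homo f : x / x \in W >-> x \in W'} :
  mquot W -> mquot W' := fun u => \pi_(mquot W') (f (repr u)).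

Lemma mquot_mapE (x : V) :
  mquot_map fWW' (\pi_(mquot W) x) = \pi_(mquot W') (f x).
Proof.
by apply/mquot_eqP; rewrite -linearB; apply/fWW'/mquot_eqP; rewrite reprK.
Qed.

Fact mquot_map_linear : linear (mquot_map fWW').
Proof.
move=> a u v; rewrite -[u]reprK -[v]reprK.
by rewrite -pi_mquotZ -pi_mquotD !mquot_mapE linearP pi_mquotD pi_mquotZ.
Qed.

HB.instance Definition _ := GRing.isLinear.Build R (mquot W) (mquot W') _
  (mquot_map fWW') mquot_map_linear.

End ModuleQuotientMap.

Section FreeModule.
Variables (R : nzRingType) (K : choiceType).

Fact fglift_scalable (M : lmodType R) (h : K -> M) : scalable (fglift h).
Proof.
have fgliftD : {morph fglift h : x y / x - y} := lift_is_additive h.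
have fglift0 : fglift h 0 = 0 by rewrite -(subrr 0) fgliftD subrr.
have fgliftN x : fglift h (- x) = - fglift h x.
  by rewrite -[- x]add0r fgliftD fglift0 add0r.
have fgliftA x y : fglift h (x + y) = fglift h x + fglift h y.
  by rewrite -[y in LHS]opprK fgliftD fgliftN opprK.
move=> a c; rewrite -[c]freeg_sumE scaler_sumr.
rewrite !(big_morph _ fgliftA fglift0) scaler_sumr.
apply: eq_bigr => k _.
suff -> : a *: << coeff k c *g k >> = << a * coeff k c *g k >>.
  by rewrite !liftU scalerA.
by apply/eqP/freeg_eqP => x; rewrite coeffZ !coeffU mulrA.
Qed.

HB.instance Definition _ (M : lmodType R) (h : K -> M) :=
  GRing.isZmodMorphism.Build {freeg K / R} M (fglift h) (lift_is_additive h).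
HB.instance Definition _ (M : lmodType R) (h : K -> M) :=
  GRing.isScalable.Build R {freeg K / R} M _ (fglift h) (fglift_scalable h).

Lemma eq_free_linear (M : lmodType R) (g h : {linear {freeg K / R} -> M}) :
  (forall k, g << k >> = h << k >>) -> g =1 h.
Proof.
move=> gh c; rewrite -[c]freeg_sumE !linear_sum; apply: eq_bigr => k _.
suff -> : << coeff k c *g k >> = coeff k c *: << k >> :> {freeg K / R}.
  by rewrite !linearZ /= gh.
by apply/eqP/freeg_eqP => x; rewrite coeffZ !coeffU mul1r.
Qed.

End FreeModule.

Section BarComplex.
Variable R : nzRingType.

(* The bar complex: [bar G n] is the free R-module on the symbols
   [g_1 | ... | g_n]. *)
Definition bar (G : groupType) (n : nat) := {freeg (n.-tuple G) / R}.

(* The i-th face of [g_1 | ... | g_n+1], 0 <= i <= n+1: it is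
   [g_2 | ... | g_n+1] for i = 0, [g_1 | ... | g_i g_i+1 | ... | g_n+1] for
   0 < i < n+1 and [g_1 | ... | g_n] for i = n+1.  Entries are numbered from 0
   below. *)
Definition bar_face (G : groupType) (n i : nat) (t : n.+1.-tuple G) :
    n.-tuple G :=
  [tuple if (j.+1 < i)%N then nth 1%g t j
         else if j.+1 == i then (nth 1%g t j * nth 1%g t j.+1)%g
         else nth 1%g t j.+1 | j < n].

Definition bar_d_basis (G : groupType) (n : nat) :
    n.-tuple G -> bar G n.-1 :=
  match n with
  | 0 => fun _ => 0
  | m.+1 => fun t => \sum_(i < m.+2) (-1) ^+ i *: << bar_face i t >>
  end.

Definition bar_d (G : groupType) (n : nat) : bar G n -> bar G n.-1 :=
  fglift (@bar_d_basis G n).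

HB.instance Definition _ (G : groupType) (n : nat) :=
  GRing.Linear.on (@bar_d G n).

Lemma bar_dU (K : groupType) (m : nat) (t : m.-tuple K) :
  bar_d << t >> = bar_d_basis t.
Proof. by rewrite /bar_d liftU scale1r. Qed.

Lemma nth_bar_face (G : groupType) (n i k : nat) (t : n.+1.-tuple G) :
  (k < n)%N ->
  nth 1%g (bar_face i t) k =
    if (k.+1 < i)%N then nth 1%g t k
    else if k.+1 == i then (nth 1%g t k * nth 1%g t k.+1)%g
    else nth 1%g t k.+1.
Proof.
by move=> kn; rewrite -[k]/(val (Ordinal kn)) -tnth_nth tnth_mktuple.
Qed.

Lemma bar_face_face (G : groupType) (n i j : nat) (t : n.+2.-tuple G) :
  (i < j)%N -> bar_face i (bar_face j t) = bar_face j.-1 (bar_face i t).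
Proof.
move=> ij; apply: eq_from_tnth => k; rewrite !tnth_mktuple.
have kn := ltn_ord k; rewrite !nth_bar_face ?ltnS ?(ltnW kn) //.
move: (nat_of_ord k) => {kn}k.
repeat match goal with
  |- context [if ?b then _ else _] => case: (boolP b) => ?
end; rewrite ?mulgA //; lia.
Qed.

Lemma bar_dd (G : groupType) (n : nat) (c : bar G n.+1) :
  bar_d (bar_d c) = 0.
Proof.
case: n c => [|n] c.
  rewrite -[LHS]/(bar_d (n := 0) _) /bar_d /bar_d_basis.
  set d := fglift _ c; rewrite -[d]freeg_sumE linear_sum big1 // => k _ /=.
  by rewrite liftU scaler0.
have lin0 : linear (fun _ : bar G n.+2 => 0 : bar G n).
  by move=> a x y; rewrite scaler0 addr0.
pose zero : {linear bar G n.+2 -> bar G n} :=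
  HB.pack (fun _ : bar G n.+2 => 0 : bar G n)
    (GRing.isLinear.Build R _ _ _ _ lin0).
apply: (eq_free_linear (g := @bar_d G n.+1 \o @bar_d G n.+2) (h := zero)).
move=> t /=; rewrite bar_dU /= linear_sum /=.
under eq_bigr => j _ do rewrite linearZ /= bar_dU /= scaler_sumr.
under eq_bigr => j _ do under eq_bigr => i _ do rewrite scalerA -exprD.
pose F (i j : nat) : bar G n :=
  (-1) ^+ (j + i) *: << bar_face i (bar_face j t) >>.
transitivity (\sum_(0 <= j < n.+3) \sum_(0 <= i < n.+2) F i j).
  by rewrite big_mkord; apply: eq_bigr => j _; rewrite big_mkord.
under eq_bigr => j _ do rewrite (bigID (fun i => (i < j)%N)) /=.
rewrite big_split /= addrC.
rewrite [X in _ + X]big_nat_recl // [X in _ + (X + _)]big_pred0 // add0r.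
rewrite [X in X + _]big_nat_recr //= [X in (_ + X) + _]big1_seq ?addr0;
  last by move=> i /andP[h]; rewrite mem_index_iota; lia.
rewrite [X in X + _](exchange_big_dep predT) //= -big_split /=.
rewrite big1_seq // => i _; apply/eqP; rewrite addr_eq0 -sumrN; apply/eqP.
rewrite [LHS]big_nat_cond [RHS]big_nat_cond.
apply: eq_big => [j|j /andP[_ ji]]; first by rewrite -leqNgt ltnS.
rewrite /F (@bar_face_face _ _ j i.+1 t); last by lia.
by rewrite /= addSn exprS mulN1r scaleNr opprK addnC.
Qed.

Section Homology.
Variables (G : groupType) (n : nat).

Definition is_cycle : {pred bar G n} := [pred c | bar_d c == 0].

Fact is_cycle_submod_closed : submod_closed is_cycle.
Proof.
split=> [|a x y /eqP dx /eqP dy]; first by rewrite inE linear0.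
by rewrite inE linearP /= dx dy scaler0 addr0.
Qed.

HB.instance Definition _ :=
  GRing.isSubmodClosed.Build R (bar G n) is_cycle is_cycle_submod_closed.

Record cycle : Type := Cycle { cycle_val : bar G n; _ : is_cycle cycle_val }.

HB.instance Definition _ := [isSub for cycle_val].
HB.instance Definition _ := [Choice of cycle by <:].
HB.instance Definition _ := [SubChoice_isSubLmodule of cycle by <:].

Definition is_boundary : {pred cycle} :=
  [pred z | `[< exists c : bar G n.+1, bar_d c = val z >]].

Fact is_boundary_submod_closed : submod_closed is_boundary.
Proof.
split=> [|a x y /asboolP[c dc] /asboolP[e de]]; apply/asboolP.
  by exists 0; rewrite !linear0.
by exists (a *: c + e); rewrite !linearP /= dc de.
Qed.

HB.instance Definition _ :=
  GRing.isSubmodClosed.Build R cycle is_boundary is_boundary_submod_closed.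

Definition homology : lmodType R := mquot is_boundary.

End Homology.

Section HomologyMap.
Variables (G H : groupType) (f : UMagmaMorphism.type G H) (n : nat).

Definition bar_map (m : nat) : bar G m -> bar H m :=
  fglift (fun t => << map_tuple f t >>).

HB.instance Definition _ (m : nat) := GRing.Linear.on (@bar_map m).

Lemma bar_face_map (m i : nat) (t : m.+1.-tuple G) :
  map_tuple f (bar_face i t) = bar_face i (map_tuple f t).
Proof.
apply: eq_from_tnth => j; rewrite tnth_map !tnth_mktuple.
have fE k : nth 1%g [tuple of map f t] k = f (nth 1%g t k).
  have [lt_k | ge_k] := ltnP k (size t); first exact: nth_map.
  by rewrite !nth_default ?size_map // gmulf1.
by rewrite /= !fE; case: ifP => // _; case: ifP => // _; rewrite gmulfM.
Qed.

Lemma bar_mapU (m : nat) (t : m.-tuple G) :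
  bar_map << t >> = << map_tuple f t >>.
Proof. by rewrite /bar_map liftU scale1r. Qed.

Lemma bar_map_d (m : nat) (c : bar G m) :
  bar_d (bar_map c) = bar_map (bar_d c).
Proof.
apply: (eq_free_linear (g := @bar_d H m \o @bar_map m)
                       (h := @bar_map m.-1 \o @bar_d G m)) => t /=.
rewrite bar_mapU !bar_dU; case: m t {c} => [|m] t /=; first by rewrite linear0.
rewrite linear_sum; apply: eq_bigr => i _.
by rewrite linearZ /= bar_mapU bar_face_map.
Qed.

Fact cycle_map_subproof (z : cycle G n) : is_cycle (bar_map (val z)).
Proof.
have /eqP dz := valP z.
by rewrite /is_cycle /= bar_map_d dz linear0.
Qed.

Definition cycle_map (z : cycle G n) : cycle H n :=
  Cycle (cycle_map_subproof z).

Fact cycle_map_linear : linear cycle_map.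
Proof. by move=> a x y; apply: val_inj; rewrite /= !linearP. Qed.

HB.instance Definition _ :=
  GRing.isLinear.Build R (cycle G n) (cycle H n) _ cycle_map cycle_map_linear.

Fact cycle_map_boundary :
  {homo cycle_map : z / z \in @is_boundary G n >-> z \in @is_boundary H n}.
Proof.
move=> z /asboolP[c dc]; apply/asboolP; exists (bar_map c).
by rewrite bar_map_d dc.
Qed.

Definition homology_map : homology G n -> homology H n :=
  mquot_map cycle_map_boundary.

HB.instance Definition _ := GRing.Linear.on homology_map.

End HomologyMap.
End BarComplex.

Arguments homology R G n : clear implicits.
Arguments homology_map R [G H] f n _.

(* Main.v *)
From HB Require Import structures.
From mathcomp Require Import all_fingroup all_solvable.
From mathcomp Require Import all_boot ssralg zmodp boolp.
From mathcomp Require Import ring.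
From mathcomp Require classical_sets.
From mathcomp.multinomials Require Import freeg.
Require Import Defs.

(** The hypotheses on homology say that finite p-groups cannot tell A from B:
    every homomorphism f from A to a finite p-group P factors as g \o phi for
    some g : B -> P ([extend_to_pgroup]).  This goes by induction on |P|.  A
    nontrivial P has a central subgroup Z of order p, and the composite
    A -> P -> P / Z extends to B by induction.  The obstruction to lifting
    B -> P / Z through P is a 2-cocycle c on B with values in F_p, and the lift
    f on A exhibits the pullback of c to A as a coboundary.  Dually to the
    surjectivity of H_2(A) -> H_2(B), the map H^2(B) -> H^2(A) is injective, so
    c is a coboundary and a lift exists; its restriction to A differs from f by
    a homomorphism A -> Z, which extends to B because H^1(B) -> H^1(A) is
    surjective, dually to the injectivity of H_1(A) -> H_1(B).  Correcting the
    lift by this extension gives g ([lift_central]).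

    Since A is finitely generated, P := A / A^(n) is a finite p-group
    ([pseries_pgroup_quot]).  Extending the projection f : A -> P to g : B -> P
    and using P^(n) = 1, an element a with phi a in B^(n) satisfies
    f a = g (phi a) = 1, so a is in A^(n) ([pseries_reflected]): this is
    injectivity at every finite stage, and intersecting over n gives the stage
    omega.

    For surjectivity, P := B / B^(n) is a finite p-group as well.  If the image
    of A in it were proper, it would lie in a maximal subgroup M, which is
    normal of index p; then B -> P / M = F_p would be a nonzero homomorphism
    vanishing on the image of A, contrary to the surjectivity of
    H_1(A) -> H_1(B) ([onto_pgroup]). *)

Set Implicit Arguments.
Unset Strict Implicit.
Unset Printing Implicit Defensive.

Import GRing.Theory.
Local Open Scope ring_scope.

(** * Extension of linear functionals *)

(** A subspace M that contains W and is maximal among those avoiding z is a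
    hyperplane complementary to the line of z: if no x - a z were in M, then
    M + F x would be a larger subspace avoiding z.  The functional reads off the
    coordinate a. *)
Lemma separating_functional (F : fieldType) (E : lmodType F) (W : E -> Prop)
    (z : E) :
  W 0 -> (forall a x y, W x -> W y -> W (a *: x + y)) -> ~ W z ->
  exists l : {linear E -> F^o}, (forall w, W w -> l w = 0) /\ l z = 1.
Proof.
move=> W0 Wlin Wz.
(* Containing W is only asked of nonempty X, so that the union of the empty
   chain qualifies. *)
pose P (X : classical_sets.set E) :=
  [/\ forall a x y, X x -> X y -> X (a *: x + y), ~ X z &
      forall x, X x -> forall w, W w -> X w].
have [C CP Ctot|M [[Mlin Mz MW] Mmax]] := @classical_sets.Zorn_bigcup E P.
  split.
  - move=> a x y [X CX Xx] [Y CY Yy].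
    have [XY | YX] := Ctot _ _ CX CY.
      have [Ylin _ _] := CP _ CY.
      by exists Y => //; apply: Ylin => //; apply: XY.
    have [Xlin _ _] := CP _ CX.
    by exists X => //; apply: Xlin => //; apply: YX.
  - by move=> [X CX Xz]; have [_ nXz _] := CP _ CX.
  - move=> x [X CX Xx] w Ww; have [_ _ XW] := CP _ CX.
    by exists X => //; exact: XW Xx _ Ww.
have M0 : M 0.
  apply: contrapT => nM0; apply: (Mmax W) => //.
  split=> [x Mx | WM]; last exact/nM0/WM.
  by case: nM0; exact: MW Mx _ W0.
have {}MW w : W w -> M w by exact: MW M0 w.
have MZ a x : M x -> M (a *: x).
  by move=> Mx; rewrite -[_ *: _]addr0; exact: Mlin.
have MB x y : M x -> M y -> M (x - y).
  by move=> Mx My; rewrite addrC -scaleN1r; exact: Mlin.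
have Mex x : exists a : F, M (x - a *: z).
  apply: contrapT => nx.
  pose N (y : E) := exists2 b : F, M (y - b *: x) & True.
  apply: (Mmax N).
    split=> [y My | NM]; first by exists 0; rewrite // scale0r subr0.
    apply: nx; exists 0; rewrite scale0r subr0; apply: NM.
    by exists 1; rewrite // scale1r subrr.
  split.
  - move=> a y1 y2 [b1 Mb1 _] [b2 Mb2 _]; exists (a * b1 + b2) => //.
    have := Mlin a _ _ Mb1 Mb2.
    by rewrite scalerBr scalerA addrACA -opprD -scalerDl.
  - move=> [b Mb _]; have [b0 | bN0] := eqVneq b 0.
      by apply: Mz; move: Mb; rewrite b0 scale0r subr0.
    apply: nx; exists b^-1; have := MZ (- b^-1) _ Mb.
    by rewrite scalerBr !scaleNr opprK scalerA mulVf // scale1r addrC.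
  - move=> _ _ w Ww; exists 0 => //; rewrite scale0r subr0; exact: MW.
have Muniq (x : E) (a b : F) : M (x - a *: z) -> M (x - b *: z) -> a = b.
  move=> Ma Mb; apply/eqP; rewrite -subr_eq0; apply/negPn/negP => abN0.
  have Mab : M ((a - b) *: z).
    have -> : (a - b) *: z = (x - b *: z) - (x - a *: z).
      by rewrite opprB [RHS]addrC subrKA scalerBl.
    exact: MB.
  by apply: Mz; have := MZ (a - b)^-1 _ Mab; rewrite scalerA mulVf // scale1r.
have [l Ml] := choice Mex.
have llin : linear (l : E -> F^o).
  move=> a x y; apply: (Muniq (a *: x + y)) => //.
  have := Mlin a _ _ (Ml x) (Ml y).
  by rewrite scalerBr scalerA addrACA -opprD -scalerDl.
pose L : {linear E -> F^o} := HB.pack (l : E -> F^o)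
  (GRing.isLinear.Build F E F^o _ (l : E -> F^o) llin).
exists L; split=> [w Ww|].
  by apply: (Muniq w) => //; rewrite scale0r subr0; exact: MW.
by apply: (Muniq z) => //; rewrite scale1r subrr.
Qed.

(** This is where duality enters: over a field, exactness of V -> V' at the
    level of vectors gives exactness at the level of functionals, without any
    bound on dimensions.  The hypothesis says that the graph of c over the image
    of u does not contain (0, 1), so a functional l on V' x F separates the two,
    and the zero set of l is the graph of the extension. *)
Lemma linear_factor (F : fieldType) (V V' : lmodType F) (u : {linear V -> V'})
    (c : {linear V -> F^o}) :
  (forall v, u v = 0 -> c v = 0) ->
  exists h : {linear V' -> F^o}, forall v, h (u v) = c v.
Proof.
move=> ker_uc.
pose W (x : (V' * F^o)%type) := exists v, x = (u v, c v).
have [||[v [/esym/ker_uc cv0 /eqP]]|l [lW l01]] :=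
    @separating_functional F (V' * F^o)%type W (0, 1).
- by exists 0; rewrite !linear0.
- by move=> a x y [v ->] [w ->]; exists (a *: v + w); rewrite !linearP.
- by rewrite cv0 oner_eq0.
have hlin : linear (fun y : V' => - l (y, 0) : F^o).
  move=> a x y; have -> : (a *: x + y, 0) = a *: (x, 0) + (y, 0) :> V' * F^o.
    by congr pair; rewrite /= scaler0 addr0.
  by rewrite linearP opprD scalerN.
exists (HB.pack (fun y : V' => - l (y, 0) : F^o)
  (GRing.isLinear.Build F V' F^o _ _ hlin) : {linear V' -> F^o}) => v /=.
have := lW (u v, c v) (ex_intro _ v erefl).
have -> : (u v, c v) = c v *: (0, 1) + (u v, 0) :> V' * F^o.
  by congr pair; rewrite /= ?scaler0 ?add0r ?addr0 // [RHS]mulr1.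
rewrite linearP l01 => /eqP; rewrite addr_eq0 => /eqP <-.
exact: mulr1.
Qed.

(** * Low-degree bar chains and homomorphisms to the field *)

Section LowDegreeBar.
Variables (R : nzRingType) (G : groupType).

Lemma bar_d1 (x : G) : bar_d (<< [tuple x] >> : bar R G 1) = 0.
Proof.
rewrite bar_dU /= !big_ord_recl big_ord0 /= !scale1r addr0 expr1 scaleN1r.
set u := bar_face 0 _; set v := bar_face _ _.
by rewrite (tuple0 u) (tuple0 v) subrr.
Qed.

Lemma bar_d2 (x y : G) :
  bar_d (<< [tuple x; y] >> : bar R G 2) =
  << [tuple y] >> - << [tuple (x * y)%g] >> + << [tuple x] >>.
Proof.
rewrite bar_dU /= !big_ord_recl big_ord0 /= addr0 addrA.
rewrite expr0 !exprS expr0 mulr1 mulN1r opprK !scale1r scaleN1r.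
congr (<< _ >> - << _ >> + << _ >>);
by apply: eq_from_tnth => i; rewrite tnth_mktuple (tnth_nth 1%g);
  case: i => [[|//] lti].
Qed.

Lemma bar_d3 (x y z : G) :
  bar_d (<< [tuple x; y; z] >> : bar R G 3) =
  << [tuple y; z] >> - << [tuple (x * y)%g; z] >>
  + << [tuple x; (y * z)%g] >> - << [tuple x; y] >>.
Proof.
rewrite bar_dU /= !big_ord_recl big_ord0 /= addr0 !addrA.
rewrite expr0 !exprS expr0 mulr1 !(mulN1r, opprK) !scale1r !scaleN1r.
congr (<< _ >> - << _ >> + << _ >> - << _ >>);
by apply: eq_from_tnth => i; rewrite tnth_mktuple (tnth_nth 1%g);
  case: i => [[|[|//]] lti].
Qed.
End LowDegreeBar.

Section QuotientProjection.
Variables (R : nzRingType) (V : lmodType R) (W : submodClosed V).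
Definition mquot_pi (x : V) : mquot W := (\pi_(mquot W) x)%qT.

Fact mquot_pi_linear : linear mquot_pi.
Proof. by move=> a x y; rewrite /mquot_pi pi_mquotD pi_mquotZ. Qed.

HB.instance Definition _ :=
  GRing.isLinear.Build R V (mquot W) _ mquot_pi mquot_pi_linear.
End QuotientProjection.

Lemma free_linear0 (R : nzRingType) (K : choiceType) (M : lmodType R)
    (g : {linear {freeg K / R} -> M}) :
  (forall k, g << k >> = 0) -> forall x, g x = 0.
Proof.
by move=> g0 x; apply: (eq_free_linear (h := \0%R)) => k; rewrite g0.
Qed.

Lemma tuple2E (T : Type) (t : 2.-tuple T) :
  t = [tuple tnth t ord0; tnth t (inord 1)].
Proof.
apply: eq_from_tnth => i; rewrite [RHS](tnth_nth (thead t)).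
by case: i => [[|[|//]] lti]; congr tnth; apply: val_inj; rewrite /= ?inordK.
Qed.

Lemma tuple3E (T : Type) (t : 3.-tuple T) :
  t = [tuple tnth t ord0; tnth t (inord 1); tnth t (inord 2)].
Proof.
apply: eq_from_tnth => i; rewrite [RHS](tnth_nth (thead t)).
by case: i => [[|[|[|//]]] lti]; congr tnth; apply: val_inj; rewrite /= ?inordK.
Qed.

Lemma additive_bar_d0 (F : fieldType) (G : groupType) (m : G -> F)
    (w : bar F G 2) :
  {morph m : x y / (x * y)%g >-> x + y} ->
  fglift (fun t : 1.-tuple G => m (thead t) : F^o) (bar_d w) = 0.
Proof.
move=> mM; apply: (free_linear0 (g := fglift _ \o @bar_d F G 2)) => t /=.
rewrite (tuple2E t) bar_d2 linearD linearB /= !liftU !scale1r mM.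
rewrite /thead !(tnth_nth 1%g) /= [X in _ - X]addrC opprD addrA.
by rewrite subrr sub0r addNr.
Qed.

Section Extension.
Variables (F : fieldType) (A B : groupType) (phi : UMagmaMorphism.type A B).

(** Surjectivity of H^1(B; F) -> H^1(A; F), in terms of homomorphisms to F: m is
    a functional on H_1(A; F), and such a functional extends along the injection
    into H_1(B; F). *)
Lemma extend_additive (m : A -> F) :
  injective (homology_map F phi 1) ->
  {morph m : x y / (x * y)%g >-> x + y} ->
  exists2 m' : B -> F, {morph m' : x y / (x * y)%g >-> x + y} &
                       forall a, m' (phi a) = m a.
Proof.
move=> inj1 mM.
have cyc1 (G : groupType) (x : G) : is_cycle (<< [tuple x] >> : bar F G 1).
  by rewrite /is_cycle /= bar_d1.
pose cl (G : groupType) (x : G) : homology F G 1 :=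
  (\pi_(homology F G 1) (Cycle (cyc1 G x)))%qT.
have clM (G : groupType) (x y : G) : cl G (x * y)%g = cl G x + cl G y.
  rewrite -pi_mquotD; apply/esym/mquot_eqP/asboolP.
  by exists << [tuple x; y] >>; rewrite bar_d2 /= addrC addrA.
have cl_map a : homology_map F phi 1 (cl A a) = cl B (phi a).
  rewrite /homology_map mquot_mapE; congr (\pi_(homology F B 1) _)%qT.
  by apply: val_inj; rewrite /= bar_mapU; congr << _ >>; apply: val_inj.
(* Working on cycles rather than classes of A avoids descending m to a
   quotient: injectivity on H_1 places the kernel of u in the boundaries. *)
pose c : {linear cycle F A 1 -> F^o} :=
  (fglift (fun t : 1.-tuple A => m (thead t) : F^o) \o val).
pose u : {linear cycle F A 1 -> homology F B 1} :=
  homology_map F phi 1 \o mquot_pi (@is_boundary F A 1).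
have [z uz0|h hu] := @linear_factor F _ _ u c; last first.
  exists (fun x => h (cl B x)) => [x y | a]; first by rewrite clM linearD.
  by rewrite -cl_map [LHS](hu (Cycle (cyc1 A a))) /= liftU scale1r.
have /mquot_eqP/asboolP[w dw] : mquot_pi (@is_boundary F A 1) z = mquot_pi _ 0.
  by apply: inj1; rewrite linear0 [RHS]linear0; exact: uz0.
rewrite subr0 in dw; rewrite /= -dw; exact: additive_bar_d0.
Qed.

(** Injectivity of H^1(B; F) -> H^1(A; F), dual to surjectivity on H_1: each
    [b] is the image of a chain of A up to a boundary, and m kills both. *)
Lemma additive_eq0 (m : B -> F) :
  surjective (homology_map F phi 1) ->
  {morph m : x y / (x * y)%g >-> x + y} ->
  (forall a, m (phi a) = 0) -> forall b, m b = 0.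
Proof.
move=> surj1 mM mphi b.
pose K : {linear bar F B 1 -> F^o} :=
  fglift (fun t : 1.-tuple B => m (thead t) : F^o).
have K_map z : K (bar_map phi z) = 0.
  apply: (free_linear0 (g := K \o @bar_map F A B phi 1)) => t /=.
  by rewrite bar_mapU liftU scale1r /thead tnth_map mphi.
have cyc_b : is_cycle (<< [tuple b] >> : bar F B 1).
  by rewrite /is_cycle /= bar_d1.
have [u] := surj1 (\pi_(homology F B 1) (Cycle cyc_b))%qT.
rewrite -[u]reprK /homology_map mquot_mapE => /esym/mquot_eqP/asboolP[w] /=.
move/eqP; rewrite eq_sym subr_eq => /eqP eb.
have <- : K << [tuple b] >> = m b by rewrite /K /= liftU scale1r.
by rewrite eb linearD K_map addr0; exact: additive_bar_d0.
Qed.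

(** Injectivity of H^2(B; F) -> H^2(A; F), dual to surjectivity on H_2.  A
    2-cycle of B is the image of a 2-cycle z of A up to a boundary; c vanishes
    on the boundary as a cocycle, and on the image of z because there it is the
    coboundary of k.  So c vanishes on 2-cycles and factors through the
    differential bar_2 -> bar_1, and the factor is h. *)
Lemma trivialize_cocycle (c : B -> B -> F) (k : A -> F) :
  surjective (homology_map F phi 2) ->
  (forall x y z,
     c y z - c (x * y)%g z + c x (y * z)%g - c x y = 0) ->
  (forall a b, c (phi a) (phi b) = k b - k (a * b)%g + k a) ->
  exists h : B -> F, forall x y, c x y = h y - h (x * y)%g + h x.
Proof.
move=> surj2 dc0 ck.
pose C : {linear bar F B 2 -> F^o} :=
  fglift (fun t : 2.-tuple B => c (tnth t ord0) (tnth t (inord 1)) : F^o).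
have CE x y : C << [tuple x; y] >> = c x y.
  by rewrite /C /= liftU scale1r !(tnth_nth 1%g) /= inordK.
have C_bnd (w : bar F B 3) : C (bar_d w) = 0.
  apply: (free_linear0 (g := C \o @bar_d F B 3)) => {w} t /=.
  by rewrite (tuple3E t) bar_d3 -[C _]/(C _) linearB linearD linearB !CE.
pose K : {linear bar F A 1 -> F^o} :=
  fglift (fun t : 1.-tuple A => k (thead t) : F^o).
have C_map (w : bar F A 2) : C (bar_map phi w) = K (bar_d w).
  apply: (eq_free_linear (g := C \o @bar_map F A B phi 2)
                         (h := K \o @bar_d F A 2)) => {w} t /=.
  rewrite (tuple2E t) bar_mapU bar_d2.
  have -> : map_tuple phi [tuple tnth t ord0; tnth t (inord 1)] =
     [tuple phi (tnth t ord0); phi (tnth t (inord 1))] by exact: val_inj.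
  rewrite CE ck -[K _]/(K _) linearD linearB /K /= !liftU !scale1r.
  by rewrite /thead !(tnth_nth 1%g).
have [v dv0|h hd] := @linear_factor F _ _ (@bar_d F B 2) C; last first.
  exists (fun x => h << [tuple x] >>) => x y.
  by rewrite -CE -hd /= bar_d2 linearD linearB.
have cyc_v : is_cycle v by rewrite /is_cycle /= dv0.
have [y] := surj2 (\pi_(homology F B 2) (Cycle cyc_v))%qT.
rewrite -[y]reprK /homology_map mquot_mapE => /esym/mquot_eqP/asboolP[w] /=.
move/eqP; rewrite eq_sym subr_eq => /eqP ->.
have /eqP dz := valP (repr y).
by rewrite linearD /= C_bnd C_map dz linear0 addr0.
Qed.
End Extension.

(** * Lifting homomorphisms to central extensions and p-groups *)

(** For a central extension of Q by F, a homomorphism g : B -> Q whose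
    restriction to A lifts to the given f has a lift to B that restricts to f.
    Choose a set-theoretic lift sigma of g, with defect the cocycle c, and write
    f = sigma zeta(k) on A.  Then k trivializes c on A, hence some h trivializes
    c on B; now k + h is additive on A, so it extends to some m on B, and
    sigma zeta(m - h) is the wanted lift. *)
Lemma lift_central (F : fieldType) (A B P Q : groupType)
    (phi : UMagmaMorphism.type A B) (zeta : F -> P) (pi : P -> Q)
    (f : A -> P) (g : B -> Q) :
  injective (homology_map F phi 1) -> surjective (homology_map F phi 2) ->
  {morph zeta : a b / a + b >-> (a * b)%g} -> injective zeta ->
  (forall a x, (zeta a * x = x * zeta a)%g) ->
  {morph pi : x y / (x * y)%g} -> surjective pi ->
  (forall x, pi x = 1%g <-> exists a, x = zeta a) ->
  {morph f : x y / (x * y)%g} -> {morph g : x y / (x * y)%g} ->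
  (forall a, g (phi a) = pi (f a)) ->
  exists2 g' : B -> P, {morph g' : x y / (x * y)%g} &
                       forall a, g' (phi a) = f a.
Proof.
move=> inj1 surj2 zetaD zeta_inj zetaC piM pi_surj pi_ker fM gM gf.
have pi1 : pi 1%g = 1%g by apply: (mulgI (pi 1%g)); rewrite -piM !mulg1.
have fiber x y : pi x = pi y -> exists a, y = (x * zeta a)%g.
  move=> xy; have [|a xya] := (pi_ker (x^-1 * y)%g).1.
    by rewrite piM -xy -piM mulVg.
  by exists a; rewrite -xya mulVKg.
have [sigma sigmaE] := choice (fun b => pi_surj (g b)).
have /choice[c cE] (t : B * B) :
    exists a, (sigma t.1 * sigma t.2 = sigma (t.1 * t.2) * zeta a)%g.
  by apply: fiber; rewrite piM !sigmaE gM.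
have {}cE x y : (sigma x * sigma y = sigma (x * y) * zeta (c (x, y)))%g.
  exact: (cE (x, y)).
have /choice[k kE] a : exists b, f a = (sigma (phi a) * zeta b)%g.
  by apply: fiber; rewrite sigmaE gf.
have sigmaM x y a b :
    (sigma x * zeta a * (sigma y * zeta b) =
     sigma (x * y) * zeta (c (x, y) + (a + b)))%g.
  rewrite -mulgA [(zeta a * _)%g]mulgA zetaC -mulgA -zetaD mulgA cE.
  by rewrite -mulgA -zetaD.
have [|a b|h hE] :=
    @trivialize_cocycle F A B phi (fun x y => c (x, y)) (fun a => - k a) surj2.
- move=> x y z.
  have zeta0 : zeta 0 = 1%g.
    by apply: (mulgI (zeta 0)); rewrite -zetaD addr0 mulg1.
  (* The cocycle identity compares the two bracketings of the product
     sigma x * sigma y * sigma z. *)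
  have xy_z := sigmaM (x * y)%g z (c (x, y)) 0.
  have x_yz := sigmaM x (y * z)%g 0 (c (y, z)).
  rewrite zeta0 mulg1 -cE in xy_z.
  rewrite zeta0 mulg1 -cE [LHS]mulgA xy_z (mulgA x y z) in x_yz.
  move/mulgI/zeta_inj: x_yz; rewrite addr0 add0r => dc.
  rewrite -[c (x, (y * z)%g)](addrK (c (y, z))) -dc; ring.
- have := fM a b; rewrite !kE sigmaM gmulfM => /mulgI/zeta_inj ->; ring.
have [x y|m mD mE] :=
    @extend_additive F A B phi (fun a => k a + h (phi a)) inj1.
  have := fM x y; rewrite !kE sigmaM !gmulfM => /mulgI/zeta_inj ->.
  by rewrite hE; ring.
exists (fun x => sigma x * zeta (m x - h x))%g => [x y|a].
  by rewrite sigmaM mD hE; congr (_ * zeta _)%g; ring.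
by rewrite mE addrK kE.
Qed.

Section CyclicOfPrimeOrder.
Variables (p : nat) (p_prime : prime p) (gT : finGroupType) (x : gT).
Hypothesis ox : #[x]%g = p.

Definition Fp_exp (a : 'F_p) : gT := (x ^+ (a : nat))%g.

Lemma Fp_expD : {morph Fp_exp : a b / a + b >-> (a * b)%g}.
Proof.
move=> a b; rewrite /Fp_exp -expgD -(expg_mod_order _ (a + b)%N) ox /=.
by congr (_ ^+ (_ %% _))%g; exact: Fp_cast.
Qed.

Lemma Fp_exp_inj : injective Fp_exp.
Proof.
move=> a b /eqP; rewrite eq_expg_mod_order ox => /eqP ab; apply: val_inj.
have ltp (c : 'F_p) : (c < p)%N by rewrite -[X in (_ < X)%N]Fp_cast.
by move: ab; rewrite !modn_small.
Qed.

Lemma mem_cycle_Fp_exp y : reflect (exists a, y = Fp_exp a) (y \in <[x]>%g).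
Proof.
apply: (iffP idP) => [/cycleP[i ->] | [a ->]]; last exact: mem_cycle.
by exists i%:R; rewrite /Fp_exp val_Fp_nat // -ox expg_mod_order.
Qed.
End CyclicOfPrimeOrder.

Section ExtendToPGroup.
Variables (p : nat) (A B : groupType) (phi : UMagmaMorphism.type A B).
Hypotheses (p_prime : prime p).
Hypotheses (inj1 : injective (homology_map 'F_p phi 1)).
Hypotheses (surj2 : surjective (homology_map 'F_p phi 2)).

(** Induction on the order of P: quotient by a central subgroup of order p,
    which exists in any nontrivial p-group, and lift. *)
Lemma extend_to_pgroup (P : finGroupType) (f : A -> P) :
  (p.-group [set: P])%g -> {morph f : x y / (x * y)%g} ->
  exists2 g : B -> P, {morph g : x y / (x * y)%g} & forall a, g (phi a) = f a.
Proof.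
have [n] := ubnP #|[set: P]%g|; elim: n => // n IHn in P f * => cardP pP fM.
have [P1 | PN1] := eqVneq [set: P]%g 1%g.
  have P1E (x : P) : x = 1%g by apply/set1gP; rewrite -P1 inE.
  by exists (fun=> 1%g) => [x y | a]; rewrite ?mulg1 // [f a]P1E.
have ZN1 : 'Z([set: P])%g != 1%g.
  by apply: contra_neq PN1 => /(trivg_center_pgroup pP).
have [_ pZ _] := pgroup_pdiv (pgroupS (center_sub _) pP) ZN1.
have [x /centerP[_ xC] ox] := Cauchy p_prime pZ.
have {}xC y : commute x y by apply: xC; rewrite inE.
have nxP (y : P) : y \in 'N(<[x]>)%g.
  by rewrite (subsetP (cent_sub _)) // cent_cycle; exact/cent1P/commute_sym/xC.
pose Q : finGroupType := coset_of <[x]>%g.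
pose pi : P -> Q := coset <[x]>%g.
have piM : {morph pi : y z / (y * z)%g} by move=> y z; rewrite /pi morphM.
have imP : [set: Q]%g = quotient [set: P] <[x]>%g.
  apply/setP=> q; rewrite inE; have [y _ ->] := cosetP q.
  by rewrite mem_quotient ?inE.
have [|||g gM gf] := IHn Q (pi \o f).
- rewrite imP -ltnS (leq_trans _ cardP) // ltnS ltn_quotient ?subsetT //.
  by rewrite cycle_eq1 -order_gt1 ox prime_gt1.
- by rewrite imP quotient_pgroup.
- by move=> y z /=; rewrite fM piM.
apply: (@lift_central 'F_p A B P Q phi (Fp_exp x) pi f g) => //.
- exact: Fp_expD.
- exact: Fp_exp_inj.
- by move=> a y; apply/esym/commuteX/commute_sym/xC.
- by move=> q; have [y _ ->] := cosetP q; exists y.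
- move=> y; split=> [/(coset_idr (nxP y)) /(mem_cycle_Fp_exp p_prime ox) //|].
  by move=> /(mem_cycle_Fp_exp p_prime ox)/coset_id.
Qed.
End ExtendToPGroup.

(** * Finiteness of the quotients by the derived p-series *)

(** The definition of [generated] quantifies over bundled subgroups; this is the
    same principle for a bare predicate. *)
Lemma generated_ind (G : groupType) (S : {pred G}) (P : G -> Prop) :
  (forall x, x \in S -> P x) -> P 1%g ->
  (forall x y, P x -> P y -> P (x * y)%g) -> (forall x, P x -> P x^-1%g) ->
  forall x, x \in generated S -> P x.
Proof.
move=> PS P1 PM PV x /generatedP gx.
pose K : {pred G} := [pred y | `[< P y >]].
have KM : mulg_closed K.
  by move=> y z /asboolP Py /asboolP Pz; apply/asboolP/PM.
have K1 : 1%g \in K by exact/asboolP.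
have KV : invg_closed K by move=> y /asboolP Py; apply/asboolP/PV.
pose Kg : groupClosed G := HB.pack K (isMulClosed.Build G K KM)
  (isMul1Closed.Build G K K1) (isInvClosed.Build G K KV).
by apply/asboolP/(gx Kg) => y /PS Py; exact/asboolP.
Qed.

(** L lists the products of powers u^i, i < p, of the entries of w, and thus
    the subgroup that they generate: finitely many commuting elements of
    exponent p generate a finite group. *)
Lemma abelian_absorbing_seq (G : groupType) (p : nat) (w : seq G) :
  (0 < p)%N -> {in w &, forall u v, (u * v = v * u)%g} ->
  {in w, forall u, (u ^+ p = 1)%g} ->
  exists2 L : seq G, (1%g \in L) &
    {in w, forall u, {in L, forall y, (u * y)%g \in L}}.
Proof.
move=> p_gt0; elim: w => [|u w IHw] wC wp.
  by exists [:: 1%g]; rewrite ?mem_head.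
have [| |L L1 Lw] := IHw.
- by move=> x y xw yw; apply: wC; rewrite inE ?xw ?yw orbT.
- by move=> x xw; apply: wp; rewrite inE xw orbT.
have up : (u ^+ p = 1)%g by apply: wp; rewrite mem_head.
exists [seq (u ^+ i * y)%g | i <- iota 0 p, y <- L].
  by apply/allpairsP; exists (0%N, 1%g); rewrite mem_iota /= mulg1.
move=> v; rewrite inE => vw _ /allpairsP[[i y] [/= ip yL ->]].
have [-> | vNu] := eqVneq v u.
  apply/allpairsP; exists ((i.+1 %% p)%N, y); rewrite mem_iota /= ltn_mod.
  split=> //; rewrite mulgA -expgS; congr (_ * _)%g.
  by rewrite [in LHS](divn_eq i.+1 p) expgD mulnC expgM up expg1n mul1g.
rewrite (negPf vNu) /= in vw.
apply/allpairsP; exists (i, (v * y)%g); split=> //; first exact: Lw.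
have uv : commute v (u ^+ i)%g.
  by apply: commuteX; apply: wC; rewrite inE ?vw ?eqxx ?orbT.
by rewrite /= !mulgA uv.
Qed.

Section FiniteQuotients.
Variables (p : nat) (p_gt0 : (0 < p)%N) (G : groupType).
Hypothesis fgG : finitely_generated G.

(** Schreier's argument.  Let R be a finite set of representatives for
    N = G^(n) and T a finite symmetric generating set of G.  The finitely many
    elements r'^-1 t r of N, with r, r' in R and t in T, have commuting images
    of exponent p modulo G^(n+1), so they generate a finite subgroup L there.
    The finite set R L is stable under left multiplication by T, since
    t r y = r' (r'^-1 t r) y for the representative r' of t r; hence it is all
    of G / G^(n+1). *)
Lemma finite_pseries_quot n :
  exists E : seq (gquot (@derived_pseries p G n)), forall u, u \in E.
Proof.
elim: n => [|n [E0 E0P]].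
  exists [:: 1%g] => u; rewrite inE -[u]reprK -pi_gquot1.
  exact/eqP/gquot_eqP.
pose Q := gquot (@derived_pseries p G n.+1).
pose pi (x : G) : Q := (\pi_Q x)%qT.
have piM : {morph pi : x y / (x * y)%g} by exact: pi_gquotM.
pose R := 1%g :: map repr E0.
have RP x : exists2 r, r \in R & (r^-1 * x)%g \in @derived_pseries p G n.
  exists (repr (\pi_(gquot (@derived_pseries p G n)) x)%qT).
    by rewrite inE map_f ?orbT.
  by apply/gquot_eqP; rewrite reprK.
have [s sP] := fgG.
pose T := s ++ [seq t^-1%g | t <- s].
pose W0 := [seq (r^-1 * tr)%g | r <- R, tr <- [seq (t * r)%g | t <- T, r <- R]].
pose W := [seq pi u | u <- W0 & u \in @derived_pseries p G n].
have WP v : v \in W -> exists2 u, u \in @derived_pseries p G n & v = pi u.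
  by case/mapP=> u; rewrite mem_filter => /andP[Nu _] ->; exists u.
have [||L L1 LW] := @abelian_absorbing_seq Q p W p_gt0.
- move=> _ _ /WP[u Nu ->] /WP[v Nv ->]; rewrite -!piM.
  apply/gquot_eqP; apply: sub_generated; apply/asboolP; left.
  by exists v, u; rewrite commgEl conjgE invgM !mulgA.
- move=> _ /WP[u Nu ->].
  have piX k : (pi u ^+ k)%g = pi (u ^+ k)%g.
    elim: k => [|k IHk]; first by rewrite !expg0 /pi pi_gquot1.
    by rewrite !expgS IHk -piM.
  rewrite piX -pi_gquot1; apply/gquot_eqP; rewrite mulg1 gpredV.
  by apply: sub_generated; apply/asboolP; right; exists u.
pose E := [seq (pi r * y)%g | r <- R, y <- L].
have ET t : t \in T -> {in E, forall e, (pi t * e)%g \in E}.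
  move=> tT _ /allpairsP[[r y] [/= rR yL ->]].
  have [r' r'R Nr'] := RP (t * r)%g.
  apply/allpairsP; exists (r', pi (r'^-1 * (t * r))%g * y)%g; split=> //=.
    apply: LW => //; apply: map_f; rewrite mem_filter Nr' /=.
    by apply: allpairs_f => //; exact: allpairs_f.
  by rewrite !mulgA -!piM mulgA mulVKg.
(* Stability under x^-1 is carried along to make the induction pass to
   inverses. *)
have EP x : {in E, forall e, (pi x * e)%g \in E} /\
            {in E, forall e, (pi x^-1 * e)%g \in E}.
  have := sP x; move: x; apply: generated_ind => [x sx | | x y | x].
  - by split; apply: ET; rewrite mem_cat ?sx // map_f ?orbT.
  - by rewrite invg1 /pi pi_gquot1; split=> e Ee; rewrite mul1g.
  - move=> [Ex ExV] [Ey EyV]; rewrite invgM !piM.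
    by split=> e Ee; rewrite -mulgA; [apply/Ex/Ey | apply/EyV/ExV].
  - by rewrite invgK => -[].
exists E => u; rewrite -[u]reprK -[X in X \in E]mulg1; apply: (EP _).1.
by apply/allpairsP; exists (1%g, 1%g); rewrite mem_head /= mulg1 /pi pi_gquot1.
Qed.
End FiniteQuotients.

(** Transports a covering enumeration into the structure on which the theory of
    finite p-groups is stated. *)
Lemma finite_group_finGroup (G : groupType) (E : seq G) :
  (forall x, x \in E) ->
  exists (P : finGroupType) (f : G -> P),
    {morph f : x y / (x * y)%g} /\ bijective f.
Proof.
move=> EP.
have indexK : pcancel (index^~ E) (fun i => Some (nth 1%g E i)).
  by move=> x; rewrite nth_index.
have finE : Finite.axiom (undup E).
  by move=> x; rewrite count_uniq_mem ?undup_uniq // mem_undup EP.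
pose P : finGroupType := HB.pack (Group.sort G)
  (Choice_isCountable.Build G indexK) (isFinite.Build G finE).
exists P, id; split=> //; exact: (Bijective (g := id)).
Qed.

Lemma derived_pseries_onto p (G H : groupType) (f : UMagmaMorphism.type G H) n :
  surjective f -> forall y, y \in @derived_pseries p H n ->
  exists2 x, x \in @derived_pseries p G n & f x = y.
Proof.
move=> f_surj; elim: n => [|n IHn] y; first by have [x] := f_surj y; exists x.
move: y; apply: generated_ind => [y | | y z | y].
- case/asboolP=> [[_ [_ [/IHn[u Nu <-] /IHn[v Nv <-] ->]]] |
                  [_ /IHn[u Nu <-] ->]].
    exists [~ u, v]%g; last by rewrite gmulfR.
    by apply: sub_generated; apply/asboolP; left; exists u, v.
  exists (u ^+ p)%g; last by rewrite gmulfXn.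
  by apply: sub_generated; apply/asboolP; right; exists u.
- by exists 1%g; rewrite ?gpred1 ?gmulf1.
- by move=> [u Nu <-] [v Nv <-]; exists (u * v)%g; rewrite ?gpredM ?gmulfM.
- by move=> [u Nu <-]; exists u^-1%g; rewrite ?gpredV ?gmulfV.
Qed.

Lemma morph_pack (G H : groupType) (f : G -> H) :
  {morph f : x y / (x * y)%g} -> exists F : UMagmaMorphism.type G H, F =1 f.
Proof.
move=> fM; have f1 : f 1%g = 1%g by apply: (mulgI (f 1%g)); rewrite -fM !mulg1.
pose F : UMagmaMorphism.type G H :=
  HB.pack f (isUMagmaMorphism.Build G H f (conj f1 fM)).
by exists F.
Qed.

Lemma expg_derived_pseries p (G : groupType) (x : G) n :
  (x ^+ (p ^ n))%g \in @derived_pseries p G n.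
Proof.
elim: n => // n IHn; rewrite expnSr expgM.
apply: sub_generated; apply/asboolP; right; eexists; [exact: IHn | by []].
Qed.

(** G / G^(n) is finite, and it is a p-group by Cauchy's theorem since the
    p^n-th powers lie in G^(n). *)
Lemma pseries_pgroup_quot p (G : groupType) n :
  prime p -> finitely_generated G ->
  exists (P : finGroupType) (f : UMagmaMorphism.type G P),
    [/\ surjective f, (p.-group [set: P])%g &
        forall x, f x = 1%g <-> x \in @derived_pseries p G n].
Proof.
move=> p_prime fgG.
have [E EP] := finite_pseries_quot (prime_gt0 p_prime) fgG n.
have [P [g [gM [g' gK g'K]]]] := finite_group_finGroup EP.
pose Q := gquot (@derived_pseries p G n).
have [x y|f fE] := @morph_pack G P (fun x => g (\pi_Q x)%qT).
  by rewrite pi_gquotM gM.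
have fker x : f x = 1%g <-> x \in @derived_pseries p G n.
  have <- : f 1%g = 1%g by exact: gmulf1.
  rewrite !fE; split=> [/(can_inj gK)/esym/gquot_eqP|Nx].
    by rewrite invg1 mul1g.
  by congr g; apply/esym/gquot_eqP; rewrite invg1 mul1g.
have f_surj : surjective f.
  by move=> y; exists (repr (g' y)); rewrite fE reprK g'K.
exists P, f; split=> //; apply/pgroupP => q q_prime /(Cauchy q_prime)[y _ oy].
have [x fx] := f_surj y.
have: (y ^+ (p ^ n) = 1)%g.
  by rewrite -fx -gmulfXn; apply/fker/expg_derived_pseries.
move/eqP; rewrite -order_dvdn oy Euclid_dvdX // => /andP[].
by rewrite dvdn_prime2 // inE.
Qed.

(** * Injectivity and surjectivity on the quotients *)

Lemma gquot_map_inj (G H : groupType) (N : normalClosed G) (M : normalClosed H)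
    (f : UMagmaMorphism.type G H) (fNM : {homo f : x / x \in N >-> x \in M}) :
  (forall x, f x \in M -> x \in N) -> injective (gquot_map fNM).
Proof.
move=> NfM u v; rewrite -[u]reprK -[v]reprK !gquot_mapE => /gquot_eqP Mf.
by apply/gquot_eqP/NfM; rewrite gmulfM gmulfV.
Qed.

Lemma gquot_map_surj (G H : groupType) (N : normalClosed G) (M : normalClosed H)
    (f : UMagmaMorphism.type G H) (fNM : {homo f : x / x \in N >-> x \in M}) :
  (forall y, exists x, ((f x)^-1 * y)%g \in M) -> surjective (gquot_map fNM).
Proof.
move=> fM v; have [x Mx] := fM (repr v).
exists (\pi_(gquot N) x)%qT; rewrite gquot_mapE -[RHS]reprK.
exact/gquot_eqP.
Qed.

Lemma inj_surj_bij (T : choiceType) (U : eqType) (f : T -> U) :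
  injective f -> surjective f -> bijective f.
Proof.
move=> f_inj f_surj.
have fP y : exists x, f x == y by have [x <-] := f_surj y; exists x.
exists (fun y => xchoose (fP y)) => [x | y]; last exact/eqP/(xchooseP (fP y)).
exact/f_inj/eqP/(xchooseP (fP (f x))).
Qed.

Section Main.
Variables (p : nat) (p_prime : prime p) (A B : groupType).
Variable phi : UMagmaMorphism.type A B.

(** With P = A / A^(n) and g : B -> P extending the projection f of A, the
    homomorphism g maps B^(n) into P^(n), which is the image of A^(n) under f
    and so is trivial. *)
Lemma pseries_reflected n :
  finitely_generated A -> injective (homology_map 'F_p phi 1) ->
  surjective (homology_map 'F_p phi 2) ->
  forall a, phi a \in @derived_pseries p B n -> a \in @derived_pseries p A n.
Proof.
move=> fgA inj1 surj2 a Na.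
have [P [f [f_surj pP fker]]] := pseries_pgroup_quot n p_prime fgA.
have [g0 g0M g0f] := extend_to_pgroup p_prime inj1 surj2 pP (@gmulfM _ _ f).
have [g gE] := morph_pack g0M.
apply/fker; rewrite -g0f -gE.
have [x Nx <-] := derived_pseries_onto f_surj (derived_pseries_homo g Na).
exact/fker.
Qed.

(** A Frattini argument: a proper image would lie in a maximal subgroup M,
    and B -> P / M = F_p would contradict [additive_eq0]. *)
Lemma onto_pgroup (P : finGroupType) (f : UMagmaMorphism.type B P) :
  surjective (homology_map 'F_p phi 1) -> (p.-group [set: P])%g ->
  surjective f -> forall y, exists a, f (phi a) = y.
Proof.
move=> surj1 pP f_surj.
pose I := [set y | `[< exists a, f (phi a) = y >]].
have gI : group_set I.
  apply/group_setP; split=> [|y z]; rewrite !inE.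
    by apply/asboolP; exists 1%g; rewrite !gmulf1.
  move=> /asboolP[a <-] /asboolP[b <-]; apply/asboolP.
  by exists (a * b)%g; rewrite !gmulfM.
have [IT | [M maxM IM]] := maximal_exists (subsetT (group gI)).
  move=> y; have: y \in I by rewrite -[I]/(gval (group gI)) IT inE.
  by rewrite inE => /asboolP.
have [_ nMP] := andP (p_maximal_normal pP maxM).
have oQ : #|quotient [set: P] M| = p.
  by rewrite card_quotient // (p_maximal_index pP maxM).
have [x Qx ox] : {x | x \in quotient [set: P] M & #[x]%g = p}.
  by apply: Cauchy; rewrite ?oQ.
(* chi is the homomorphism P -> P / M = <[x]> = F_p, the last identification
   being the discrete logarithm to base x. *)
have Qcyc : <[x]>%g = quotient [set: P] M.
  by apply/eqP; rewrite eqEcard cycle_subG Qx oQ -ox /=.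
have nMy (y : P) : y \in 'N(M)%g by rewrite (subsetP nMP) ?inE.
have chiP (y : P) : exists k : 'F_p, coset M y = Fp_exp x k.
  by apply/(mem_cycle_Fp_exp p_prime ox); rewrite Qcyc mem_quotient ?inE.
have [chi chiE] := choice chiP.
have chi0 y : coset M y = 1%g -> chi y = 0.
  by move=> My; apply: (Fp_exp_inj p_prime ox); rewrite -chiE My.
have: forall b, chi (f b) = 0.
  apply: (additive_eq0 surj1) => [b c | a].
    by apply: (Fp_exp_inj p_prime ox); rewrite Fp_expD // -!chiE gmulfM morphM.
  apply/chi0/coset_id/(subsetP IM); rewrite inE; apply/asboolP; by exists a.
move=> chif0; have := maxgroupp maxM; rewrite properE => /andP[_ /negP[]].
apply/subsetP=> y _; have [b <-] := f_surj y.
by apply: coset_idr => //; rewrite chiE chif0.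
Qed.
End Main.

Theorem corollary4p3 (p : nat) (p_prime : prime p) (A B : groupType)
    (fgA : finitely_generated A) (fgB : finitely_generated B)
    (phi : UMagmaMorphism.type A B)
    (H2_epi : surjective (homology_map 'F_p phi 2)) :
  [/\ bijective (homology_map 'F_p phi 1) ->
        forall n : nat, bijective (pseries_quot_map p phi n),
      injective (homology_map 'F_p phi 1) ->
        forall n : nat, injective (pseries_quot_map p phi n)
    & injective (homology_map 'F_p phi 1) ->
        injective (pseries_omega_quot_map p phi)].
Proof.
have inj (inj1 : injective (homology_map 'F_p phi 1)) n :
    injective (pseries_quot_map p phi n).
  by apply: gquot_map_inj; exact: (pseries_reflected p_prime fgA inj1 H2_epi).
split=> // [bij1 n | inj1].
  apply: inj_surj_bij; first exact/inj/bij_inj.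
  have [h _ hK] := bij1.
  have surj1 : surjective (homology_map 'F_p phi 1) by move=> y; exists (h y).
  have [P [f [f_surj pP fker]]] := pseries_pgroup_quot n p_prime fgB.
  apply: gquot_map_surj => b.
  have [a fa] := onto_pgroup p_prime surj1 pP f_surj (f b).
  by exists a; apply/fker; rewrite gmulfM gmulfV fa mulVg.
apply: gquot_map_inj => a /asboolP Na; apply/asboolP => n.
exact: (pseries_reflected p_prime fgA inj1 H2_epi) (Na n).
Qed.
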